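(* (Shifted Linear Chain Trick) Consider the scalar distributed-delay equation $$\dot y(t)=\mathcal{F}\left(y(t),\int_{-\infty}^{t} g^n(t-s)\,y(s)\,ds,\;t\right),$$ where $g^n$ is the $n$-th order shifted Erlang kernel with minimum delay $\tau_{\mathrm{m}}$ and scale parameter $\Delta$. An equivalent system is given by $$\begin{aligned} \dot y(t)&=\mathcal{F}(y(t),x_n(t),t),\\ \dot x_1(t)&=\frac{1}{\Delta}\left[y(t-\tau_{\mathrm{m}})-x_1(t)\right],\\ \dot x_k(t)&=\frac{1}{\Delta}\left[x_{k-1}(t)-x_k(t)\right],\quad k=2,3,\dots,n. \end{aligned}$$
   Context: For an integer $k\ge1$, scale parameter $\Delta>0$ and minimum delay $\tau_{\mathrm{m}}\ge0$, the $k$-th order shifted Erlang kernel is (the superscript is an index, not a power) $$g^k(s)=\begin{cases}0, & 0\le s<\tau_{\mathrm{m}},\\[1mm] \dfrac{(s-\tau_{\mathrm{m}})^{k-1}\exp\left(-\frac{s-\tau_{\mathrm{m}}}{\Delta}\right)}{\Delta^k\,(k-1)!}, & s\ge\tau_{\mathrm{m}},\end{cases}$$ with $g^1(\tau_{\mathrm{m}})=1/\Delta$. Here $y$ is a scalar (real-valued) state variable, $\mathcal{F}$ is the given right-hand side, and a dot denotes the derivative with respect to $t$. The auxiliary variables $x_k:\mathbb{R}\to\mathbb{R}$, $k=1,\dots,n$, are defined by $x_k(t)=\int_{-\infty}^{t} y(s)\,g^k(t-s)\,ds$, so that $x_n$ is the distributed-delay term. The equivalence is understood in the sense that the distributed-delay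 equation can be represented by the system with one constant delay coupled to the $n$ auxiliary equations, provided the auxiliary histories satisfy these convolution definitions on the initial history interval. *)

(* Defs.v *)
From HB Require Import structures.
From mathcomp Require Import all_boot all_order all_algebra.
From mathcomp Require Import all_classical all_reals all_analysis.
Set Implicit Arguments.
Unset Strict Implicit.
Unset Printing Implicit Defensive.
Import Order.TTheory GRing.Theory Num.Theory.
Import numFieldNormedType.Exports.
Local Open Scope classical_set_scope.
Local Open Scope ring_scope.

(* Meaningful for 1 <= k. Since x ^+ 0 = 1 also at x = 0, the value at s = tau
   is Delta^-1 when k = 1. *)
Definition erlang_kernel (R : realType) (Delta tau : R) (k : nat) (s : R) : R :=
  if s < tau then 0
  else (s - tau) ^+ k.-1 * expR (- ((s - tau) / Delta))
       / (Delta ^+ k * (k.-1)`!%:R).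

(* s |-> y(s) g^k(t - s), to be integrated over s <= t. *)
Definition erlang_integrand (R : realType) (Delta tau : R) (k : nat)
    (y : R -> R) (t : R) : R -> R :=
  fun s => y s * erlang_kernel Delta tau k (t - s).

(* The (real-valued) Lebesgue integral is total, with a conventional value when
   the integrand is not integrable; integrability is erlang_conv_defined. *)
Definition erlang_conv (R : realType) (Delta tau : R) (k : nat)
    (y : R -> R) (t : R) : R :=
  \int[@lebesgue_measure R]_(s in `]-oo, t]) erlang_integrand Delta tau k y t s.

Definition erlang_conv_defined (R : realType) (Delta tau : R) (k : nat)
    (y : R -> R) (t : R) : Prop :=
  (@lebesgue_measure R).-integrable `]-oo, t]
    (EFin \o erlang_integrand Delta tau k y t).

(* f is a solution on [t0, +oo[ of f' = rhs: the derivative is two-sided at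
   t > t0, and f is continuous from the right at the initial time t0. *)
Definition solves_from (R : realType) (t0 : R) (f rhs : R -> R) : Prop :=
  {within `[t0, +oo[, continuous f} /\
  forall t : R, t0 < t -> is_derive t 1 f (rhs t).

Definition distributed_delay_equation (R : realType) (n : nat)
    (Delta tau t0 : R) (F : R -> R -> R -> R) (y : R -> R) : Prop :=
  solves_from t0 y (fun t => F (y t) (erlang_conv Delta tau n y t) t).

(* Only the components x k with 1 <= k <= n are used. *)
Definition linear_chain_system (R : realType) (n : nat)
    (Delta tau t0 : R) (F : R -> R -> R -> R)
    (y : R -> R) (x : nat -> R -> R) : Prop :=
  [/\ solves_from t0 y (fun t => F (y t) (x n t) t),
      solves_from t0 (x 1%N) (fun t => Delta^-1 * (y (t - tau) - x 1%N t))
    & forall k : nat, (2 <= k <= n)%N ->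
        solves_from t0 (x k) (fun t => Delta^-1 * (x k.-1 t - x k t))].

(* Main.v *)
(* With w(s) = exp(s / Delta) y(s), the convolution with the (k+1)-st kernel is
   Delta^-(k+1) exp(-(t - tau) / Delta) times the (k+1)-fold iterated integral
     H_k(u) = \int_{-oo}^u (u - s)^k / k! w(s) ds   at u = t - tau,
   and H_{k+1}' = H_k, H_0' = w; this gives the chain of equations for the
   convolutions. Convergence at one time t0 for k = n - 1 controls all moments of
   w of order < n, hence all convolutions at all times. Conversely a solution of
   the chain agreeing with the convolutions up to t0 agrees with them later,
   because each equation is a linear ODE in its own unknown. *)
Require Import Defs.
From HB Require Import structures.
From mathcomp Require Import all_boot all_order all_algebra.
From mathcomp Require Import all_classical all_reals all_analysis.
From mathcomp Require Import measurable_realfun ring lra.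
Import Order.TTheory GRing.Theory Num.Theory.
Import numFieldNormedType.Exports.
Local Open Scope classical_set_scope.
Local Open Scope ring_scope.

(** * Integrability on left half-lines and divided powers *)

(** Only the tail at minus infinity matters: on the compact piece between the endpoints continuity
    gives integrability. *)
Lemma integrable_itvNy_continuous (R : realType) (f : R -> R) (a b : R) :
  continuous f ->
  (@lebesgue_measure R).-integrable `]-oo, a] (EFin \o f) ->
  (@lebesgue_measure R).-integrable `]-oo, b] (EFin \o f).
Proof.
move=> cf fa; have [ba|/ltW ab] := leP b a.
  apply: integrableS fa => //.
  by apply: subset_itvl; rewrite bnd_simp.
have fab : (@lebesgue_measure R).-integrable `[a, b] (EFin \o f).
  apply: continuous_compact_integrable; first exact: segment_compact.
  exact: continuous_subspaceT.
have f1 : (@lebesgue_measure R).-integrable `]-oo, b] ((EFin \o f) \_ `]-oo, a]).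
  apply/integrable_restrict => //; apply: integrableS fa => //.
  exact: measurableI.
have f2 : (@lebesgue_measure R).-integrable `]-oo, b] ((EFin \o f) \_ `]a, b]).
  apply/integrable_restrict => //; apply: integrableS fab => //.
    exact: measurableI.
  move=> s [_]; rewrite /= !in_itv/= => /andP[/ltW-> ->] //.
apply: eq_integrable (integrableD _ f1 f2) => // s.
rewrite inE /= in_itv/= => sb; rewrite !patchE !mem_setE !in_itv/= sb andbT.
by case: leP => _; rewrite ?adde0 ?add0e.
Qed.

(* Divided powers: with this normalisation the derivative and the binomial
   formula have no coefficients. *)
Definition dpow {R : realType} (k : nat) (x : R) : R := x ^+ k / k`!%:R.

Lemma is_derive_dpow0 (R : realType) (u : R) : is_derive u 1 (dpow 0) 0.
Proof.
rewrite (_ : dpow 0 = cst 1); first exact: is_derive_cst.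
by apply/funext => x; rewrite /dpow expr0 fact0 divr1.
Qed.

Lemma is_derive_dpowS (R : realType) (k : nat) (u : R) :
  is_derive u 1 (dpow k.+1) (dpow k u).
Proof.
rewrite (_ : dpow k.+1 = k.+1`!%:R^-1 \*: (@id R ^+ k.+1)); last first.
  by apply/funext => x; rewrite /dpow mulrC fctE.
apply: is_derive_eq.
rewrite /dpow /GRing.scale /= mulr1 factS natrM.
have k0 : k.+1%:R != 0 :> R by rewrite pnatr_eq0.
by rewrite invfM mulrACA mulrCA mulVf// mul1r mulrC.
Qed.

Lemma continuous_dpow (R : realType) (k : nat) : continuous (@dpow R k).
Proof.
by move=> u; apply: cvgM; [exact: exprn_continuous|exact: cvg_cst].
Qed.

Lemma dpowD (R : realType) (k : nat) (x y : R) :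
  dpow k (x + y) = \sum_(j < k.+1) dpow j x * dpow (k - j) y.
Proof.
rewrite /dpow addrC exprDn mulr_suml; apply: eq_bigr => -[j /= jk] _.
rewrite ltnS in jk.
have fn0 m : m`!%:R != 0 :> R by rewrite pnatr_eq0 -lt0n fact_gt0.
rewrite -[k`!%:R](_ : 'C(k, j)%:R * (j`!%:R * (k - j)`!%:R) = _); last first.
  by rewrite -!natrM bin_fact.
have b0 : 'C(k, j)%:R != 0 :> R by rewrite pnatr_eq0 -lt0n bin_gt0.
rewrite -mulr_natr; field.
by rewrite b0 !fn0.
Qed.

(** * Moments and iterated integrals *)

(** Powers of [- s] are used because [dpowD] expands [dpow k (u - s)] in them. *)
Definition moments_integrable {R : realType} (n : nat) (f : R -> R) : Prop :=
  forall (j : nat) (u : R), (j <= n)%N -> (@lebesgue_measure R).-integrable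
    `]-oo, u] (EFin \o (fun s => dpow j (- s) * f s)).

(** Cauchy's formula for repeated integration; [k = 0] is already one integration. *)
Definition iterated_integral {R : realType} (k : nat) (f : R -> R) (u : R) : R :=
  \int[@lebesgue_measure R]_(s in `]-oo, u]) (dpow k (u - s) * f s).

Section iterated_integral.
Context {R : realType} (n : nat) (f : R -> R).
Hypotheses (cf : continuous f) (mf : moments_integrable n f).
Let mu := @lebesgue_measure R.

Let dpow_shift (k : nat) (v : R) :
  (fun s => dpow k (v - s) * f s) =
  (fun s => \sum_(j < k.+1) (dpow j v * (dpow (k - j) (- s) * f s))).
Proof.
apply/funext => s; rewrite dpowD mulr_suml.
by apply: eq_bigr => j _; rewrite mulrA.
Qed.

Let summand_integrable (k j : nat) (u v : R) : (k <= n)%N ->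
  mu.-integrable `]-oo, u]
    (EFin \o (fun s => dpow j v * (dpow (k - j) (- s) * f s))).
Proof.
move=> kn; have kjn : (k - j <= n)%N by rewrite (leq_trans _ kn)// leq_subr.
exact: (integrableZl _ (dpow j v) (mf _ u kjn)).
Qed.

Lemma integrable_dpow_shift (k : nat) (u v : R) : (k <= n)%N ->
  mu.-integrable `]-oo, u] (EFin \o (fun s => dpow k (v - s) * f s)).
Proof.
move=> kn; rewrite dpow_shift.
rewrite (_ : _ \o _ = fun s => (\sum_(j < k.+1)
    (EFin \o (fun s => dpow j v * (dpow (k - j) (- s) * f s))%R) s)%E); last first.
  by apply/funext => s /=; rewrite sumEFin.
by apply: integrable_sum => // j _; exact: summand_integrable.
Qed.

(* Expanding the kernel separates the endpoint u from the integration variable,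
   so that differentiating under the integral sign is avoided. *)
Lemma iterated_integral_moments (k : nat) : (k <= n)%N ->
  iterated_integral k f = \sum_(j < k.+1)
    (dpow j * (fun u => \int[mu]_(s in `]-oo, u]) (dpow (k - j) (- s) * f s))).
Proof.
move=> kn; apply/funext => u; rewrite /iterated_integral dpow_shift.
rewrite fct_sumE /Rintegral.
rewrite (_ : (\int[_]_(x in _) _)%E = (\int[mu]_(s in `]-oo, u]) \sum_(j < k.+1)
    ((EFin \o (fun s => dpow j u * (dpow (k - j) (- s) * f s))%R) s))%E); last first.
  by apply: eq_integral => s _; rewrite /= sumEFin.
rewrite integral_sum//; last by move=> j; exact: summand_integrable.
rewrite -sum_fine; last first.
  by move=> j _; apply: integrable_fin_num => //; exact: summand_integrable.
apply: eq_bigr => j _.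
have kjn : (k - j <= n)%N by rewrite (leq_trans _ kn)// leq_subr.
by apply: (RintegralZl (dpow j u) _ (mf _ u kjn)).
Qed.

Let is_derive_moment (j : nat) (u : R) : (j <= n)%N ->
  is_derive u 1 (fun u => \int[mu]_(s in `]-oo, u]) (dpow j (- s) * f s))
    (dpow j (- u) * f u).
Proof.
move=> jn.
(* The fundamental theorem is applied at interior points, hence an endpoint beyond [u]. *)
have uu1 : u < u + 1 by rewrite ltrDl.
have [| |du <-] := continuous_FTC1 uu1 (mf _ (u + 1) jn).
- by rewrite ltNyr.
- apply: cvgM; last exact: cf.
  by apply: continuous_comp; [exact: opp_continuous|exact: continuous_dpow].
by rewrite derive1E; exact: derivableP.
Qed.

Lemma is_derive_iterated_integral0 (u : R) :
  is_derive u 1 (iterated_integral 0 f) (f u).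
Proof.
rewrite iterated_integral_moments// big_ord1.
have := is_deriveM (is_derive_dpow0 _ u) (is_derive_moment 0 u isT).
by rewrite /dpow !expr0 fact0 divr1 scaler0 addr0 scale1r mul1r.
Qed.

Lemma is_derive_iterated_integralS (k : nat) (u : R) : (k < n)%N ->
  is_derive u 1 (iterated_integral k.+1 f) (iterated_integral k f u).
Proof.
move=> kn; rewrite iterated_integral_moments//.
pose M j u := \int[mu]_(s in `]-oo, u]) (dpow j (- s) * f s).
(* Product rule for the [j]-th summand; [dpow 0] is constant, so [j = 0] has no second term. *)
pose dj (j : nat) : R := dpow j u * (dpow (k.+1 - j) (- u) * f u) +
  (if j is i.+1 then M (k.+1 - j)%N u * dpow i u else 0).
have : is_derive u 1
    (\sum_(j < k.+2) (dpow j * M (k.+1 - j)%N)) (\sum_(j < k.+2) dj j).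
  apply: is_derive_sum => -[j jk].
  have dM : is_derive u 1 (M (k.+1 - j)%N) (dpow (k.+1 - j) (- u) * f u).
    by apply: is_derive_moment; rewrite (leq_trans _ kn)// leq_subr.
  rewrite /dj /=; case: j jk dM => [|i] _ dM.
    by have := is_deriveM (is_derive_dpow0 _ u) dM; rewrite scaler0.
  exact: (is_deriveM (is_derive_dpowS _ i u) dM).
rewrite big_split/=.
(* The terms from differentiating the moments resum by [dpowD] to [dpow k.+1 (u - u) * f u], which
   is zero. *)
rewrite [X in X + _](_ : _ = 0) ?add0r; last first.
  under eq_bigr do rewrite mulrA.
  by rewrite -mulr_suml -dpowD subrr /dpow expr0n mul0r mul0r.
(* In the other sum the term [j = 0] vanishes, and shifting the index gives the moment expansion of
   order [k]. *)
rewrite [X in is_derive _ _ _ X]big_ord_recl/= add0r.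
move=> dH; apply: (is_derive_eq dH).
rewrite [iterated_integral k f]iterated_integral_moments ?(ltnW kn)// fct_sumE.
by apply: eq_bigr => i _; rewrite mulrC.
Qed.

End iterated_integral.

(** * Erlang convolutions as iterated integrals *)

Section erlang.
Context {R : realType} (Delta tau : R) (y : R -> R).
Hypotheses (Delta_gt0 : 0 < Delta) (tau_ge0 : 0 <= tau) (cy : continuous y).
Let mu := @lebesgue_measure R.
Let w (s : R) : R := expR (s / Delta) * y s.
(** The factor free of [s] in the kernel of order [k.+1], once exp(s / Delta) has been moved into
    [w]. *)
Let amp (k : nat) (t : R) : R := expR (- ((t - tau) / Delta)) / Delta ^+ k.+1.

Let cw : continuous w.
Proof.
move=> s; apply: cvgM; last exact: cy.
apply: continuous_comp; last exact: continuous_expR.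
by apply: cvgM; [exact: cvg_id|exact: cvg_cst].
Qed.

Let amp_gt0 (k : nat) (t : R) : 0 < amp k t.
Proof. by rewrite divr_gt0 ?expR_gt0 ?exprn_gt0. Qed.

(** The kernel vanishes for [s > t - tau], so the minimum delay becomes a truncation of the
    domain. *)
Lemma erlang_integrand_patch (k : nat) (t : R) :
  erlang_integrand Delta tau k.+1 y t =
  (fun s => amp k t * (dpow k (t - tau - s) * w s)) \_ `]-oo, t - tau].
Proof.
apply/funext => s; rewrite /erlang_integrand /erlang_kernel patchE mem_setE.
rewrite in_itv/= lerBrDl -lerBrDr.
have [//|tau_le] := ltP; first by rewrite mulr0.
rewrite /amp /w /dpow [t - s - tau]addrAC/=.
rewrite [- ((t - tau - s) / Delta)](_ : _ = - ((t - tau) / Delta) + s / Delta).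
  2: by rewrite [_ / Delta in LHS]mulrBl opprB addrC.
rewrite expRD.
have fn0 : k`!%:R != 0 :> R by rewrite pnatr_eq0 -lt0n fact_gt0.
have D0 : Delta ^+ k.+1 != 0 by rewrite expf_neq0// gt_eqF.
by field; rewrite fn0.
Qed.

(** Here [tau_ge0] enters: the truncation point does not exceed [t]. *)
Let subset_itv_delay (t : R) :
  `]-oo, t] `&` `]-oo, t - tau] = `]-oo, t - tau]%classic.
Proof. by apply/setIidPr/subset_itvl; rewrite bnd_simp gerBl. Qed.

Lemma erlang_conv_definedE (k : nat) (t : R) :
  erlang_conv_defined Delta tau k.+1 y t <->
  mu.-integrable `]-oo, t - tau] (EFin \o (fun s => dpow k (t - tau - s) * w s)).
Proof.
rewrite /erlang_conv_defined erlang_integrand_patch -restrict_EFin.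
apply: (iff_trans (iff_sym (integrable_restrict _ _ _ _))) => //.
rewrite subset_itv_delay; split => [|] h.
  apply: eq_integrable (integrableZl _ (amp k t)^-1 h) => // s _.
  by rewrite /= -EFinM mulKf// gt_eqF.
exact: (integrableZl _ (amp k t) h).
Qed.

Lemma erlang_convE (k : nat) (t : R) :
  erlang_conv_defined Delta tau k.+1 y t ->
  erlang_conv Delta tau k.+1 y t = amp k t * iterated_integral k w (t - tau).
Proof.
move=> /erlang_conv_definedE h; rewrite /erlang_conv erlang_integrand_patch.
rewrite -Rintegral_mkcondr subset_itv_delay.
by apply: (RintegralZl (amp k t) _ h).
Qed.

(** Far to the left, |s|^j with [j <= k] is dominated by a constant times (u0 - s)^k; continuity
    covers the rest. *)
Lemma erlang_conv_defined_moments (k : nat) (t0 : R) :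
  erlang_conv_defined Delta tau k.+1 y t0 -> moments_integrable k w.
Proof.
move=> /erlang_conv_definedE h j u jk; pose u0 := t0 - tau.
have cm i (v c : R) : continuous (fun s => dpow i (v + c * s) * w s).
  move=> s; apply: cvgM; last exact: cw.
  apply: (continuous_comp (f := fun s => v + c * s)); last exact: continuous_dpow.
  by apply: cvgD; [exact: cvg_cst|apply: cvgM; [exact: cvg_cst|exact: cvg_id]].
have cmj : continuous (fun s => dpow j (- s) * w s).
  by have := cm j 0 (- 1); under eq_fun do rewrite add0r mulN1r.
(* Left of [u0 - 1] one has [1 <= u0 - s], so the exponent may be raised from [j] to [k]. *)
apply: (@integrable_itvNy_continuous _ _ (u0 - 1)) => //.
(* The power comes from |s| <= (1 + |u0|) (u0 - s); the factorial cancels the one in [dpow k]. *)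
pose C : R := (1 + `|u0|) ^+ j * k`!%:R.
have hC : mu.-integrable `]-oo, u0 - 1]
    (EFin \o (fun s => C * (dpow k (u0 - s) * w s))).
  have h1 : mu.-integrable `]-oo, u0 - 1]
      (EFin \o (fun s => dpow k (u0 - s) * w s)).
    by apply: integrableS h => //; apply: subset_itvl; rewrite bnd_simp gerBl.
  exact: (integrableZl _ C h1).
apply: le_integrable hC => //.
  apply/measurable_EFinP; apply: measurable_funTS.
  exact: continuous_measurable_fun.
move=> s; rewrite /= in_itv/= => su; rewrite lee_fin.
rewrite /C /dpow !normrM !normrX normrN [leRHS]mulrA ler_wpM2r//.
have fge1 m : 1 <= m`!%:R :> R by rewrite ler1n fact_gt0.
have f0 m : m`!%:R != 0 :> R by rewrite gt_eqF// (lt_le_trans _ (fge1 m)).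
have v1 : 1 <= u0 - s by lra.
have u0_ge0 : 0 <= `|u0| by [].
have -> : `|1 + `|u0| | = 1 + `|u0| by rewrite ger0_norm// addr_ge0.
have -> : `|u0 - s| = u0 - s by rewrite ger0_norm//; lra.
rewrite !normfV !normr_nat.
rewrite -mulrA [_ / _ in leRHS]mulrC mulVKf//.
apply: (@le_trans _ _ (`|s| ^+ j)).
  by rewrite ler_pdivrMr ?(lt_le_trans ltr01)// ler_peMr// exprn_ge0.
apply: (@le_trans _ _ (((1 + `|u0|) * (u0 - s)) ^+ j)).
  have us0 : 0 <= u0 - s by lra.
  have u01 : 0 <= 1 + `|u0| by lra.
  rewrite lerXn2r ?nnegrE ?(mulr_ge0 u01)//.
  have := ler_norm (- u0); have := ler_norm u0; rewrite normrN => *.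
  (* Triangle inequality for s = u0 - (u0 - s); then |u0| is enlarged by the factor [u0 - s]. *)
  have : `|s| <= `|u0| + (u0 - s).
    by rewrite -{1}(subKr u0 s) (le_trans (ler_normB _ _))// lerD2l ger0_norm//; lra.
  have : `|u0| <= `|u0| * (u0 - s) by rewrite ler_peMr.
  lra.
rewrite exprMn ler_wpM2l// ?exprn_ge0 ?addr_ge0//.
by rewrite ler_weXn2l.
Qed.

Lemma moments_erlang_conv_defined (n k : nat) (t : R) :
  moments_integrable n w -> (k <= n)%N ->
  erlang_conv_defined Delta tau k.+1 y t.
Proof.
by move=> mw kn; apply/erlang_conv_definedE; exact: (integrable_dpow_shift n).
Qed.

Let is_derive_amp (k : nat) (t : R) :
  is_derive t 1 (amp k) (- (Delta^-1 * amp k t)).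
Proof.
have dl : is_derive t 1 (fun t => - ((t - tau) / Delta)) (- Delta^-1).
  rewrite (_ : (fun _ => _) = (- Delta^-1) \*: (@id R - cst tau)); last first.
    by apply/funext => s; rewrite [RHS](_ : _ = - Delta^-1 * (s - tau))//; ring.
  by apply: is_derive_eq; rewrite /GRing.scale/= subr0 mulr1.
have de := @is_derive1_comp _ expR _ t _ _ (is_derive_expR _) dl.
have := is_deriveZ (Delta ^+ k.+1)^-1 de.
rewrite (_ : _ \*: _ = amp k); last by apply/funext => s; rewrite /amp mulrC.
by move=> h; apply: (is_derive_eq h); rewrite /amp /GRing.scale/=; ring.
Qed.

Let is_derive_delay (f : R -> R) (t df : R) :
  is_derive (t - tau) 1 f df -> is_derive t 1 (fun t => f (t - tau)) df.
Proof.
move=> dfx; have dl : is_derive t 1 (fun t => t - tau) 1.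
  have := is_deriveB (is_derive_id t 1) (is_derive_cst tau t 1).
  by rewrite subr0.
by have := @is_derive1_comp _ f _ t _ _ dfx dl; rewrite mulr1.
Qed.

Section moments.
Context (n : nat).
Hypothesis mw : moments_integrable n w.

(** In the product rule the decay of [amp] gives the loss term, and the integral gives the delayed
    input. *)
Lemma is_derive_erlang_conv1 (t : R) :
  is_derive t 1 (erlang_conv Delta tau 1 y)
    (Delta^-1 * (y (t - tau) - erlang_conv Delta tau 1 y t)).
Proof.
have dH := is_derive_delay _ _ _ (is_derive_iterated_integral0 n w cw mw (t - tau)).
have := is_deriveM (is_derive_amp 0 t) dH.
rewrite (_ : _ * _ = erlang_conv Delta tau 1 y); last first.
  apply/funext => s; rewrite erlang_convE//.
  exact: (moments_erlang_conv_defined n).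
move=> h; apply: (is_derive_eq h); rewrite erlang_convE; last first.
  exact: (moments_erlang_conv_defined n).
(* The exponentials of [amp] and [w] cancel at the delayed time. *)
have aw : amp 0 t * w (t - tau) = Delta^-1 * y (t - tau).
  by rewrite /amp /w expr1 mulrACA -expRD addNr expR0 mul1r.
by rewrite /GRing.scale/= aw; ring.
Qed.

(** As for the first kernel, except that the input is the previous convolution: [amp k.+1] is
    [amp k] divided by [Delta]. *)
Lemma is_derive_erlang_convS (k : nat) (t : R) : (k < n)%N ->
  is_derive t 1 (erlang_conv Delta tau k.+2 y)
    (Delta^-1 *
      (erlang_conv Delta tau k.+1 y t - erlang_conv Delta tau k.+2 y t)).
Proof.
move=> kn.
have dH := is_derive_delay _ _ _ (is_derive_iterated_integralS n w cw mw k (t - tau) kn).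
have := is_deriveM (is_derive_amp k.+1 t) dH.
rewrite (_ : _ * _ = erlang_conv Delta tau k.+2 y); last first.
  apply/funext => s; rewrite erlang_convE//.
  exact: (moments_erlang_conv_defined n).
move=> h; apply: (is_derive_eq h); rewrite !erlang_convE.
- rewrite /GRing.scale/= /amp [Delta ^+ k.+2]exprS invfM; ring.
- exact: (moments_erlang_conv_defined n).
- exact: (moments_erlang_conv_defined n _ _ mw (ltnW kn)).
Qed.

End moments.
End erlang.

(** * Uniqueness for linear equations and the equivalence *)

(** Integrating factor: exp(c t) (f - g) has zero derivative after [t0], so the mean value theorem
    makes it constant. *)
Lemma linear_ode_unique (R : realType) (t0 c : R) (f g h : R -> R) :
  solves_from t0 f (fun t => c * (h t - f t)) ->
  solves_from t0 g (fun t => c * (h t - g t)) ->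
  f t0 = g t0 -> forall t, t0 <= t -> f t = g t.
Proof.
move=> [cf df] [cg dg] fg0 t; rewrite le_eqVlt => /predU1P[<-//|t0t].
pose e (s : R) : R := expR (c * s).
have de (s : R) : is_derive s 1 e (c * e s).
  have dl : is_derive s 1 ( *%R c) c.
    apply: (is_derive_eq (is_deriveZ c (is_derive_id s 1))).
    by rewrite /GRing.scale/= mulr1.
  by have := @is_derive1_comp _ expR _ s _ _ (is_derive_expR _) dl; rewrite mulrC.
have ce : continuous e.
  by move=> s; apply: differentiable_continuous; apply/derivable1_diffP; case: (de s).
have [| |s _] := @MVT _ (e * (f - g)) (cst 0) t0 t t0t.
- move=> s; rewrite in_itv/= => /andP[t0s _].
  apply: (is_derive_eq (is_deriveM (de s) (is_deriveB (df _ t0s) (dg _ t0s)))).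
  by rewrite /GRing.scale/= !fctE; ring.
- apply: (@continuous_subspaceW _ _ _ `[t0, +oo[).
    by apply: subset_itvl.
  move=> s; apply: cvgM; first exact: continuous_subspaceT.
  by apply: cvgB; [exact: cf|exact: cg].
- rewrite mul0r !fctE fg0 subrr mulr0 subr0 => /eqP.
  by rewrite mulf_eq0 gt_eqF ?expR_gt0//= subr_eq0 => /eqP.
Qed.

Lemma solves_from_derive (R : realType) (t0 : R) (f rhs : R -> R) :
  (forall t : R, is_derive t 1 f (rhs t)) -> solves_from t0 f rhs.
Proof.
move=> df; split => [|t _ //]; apply: continuous_subspaceT => t.
by apply: differentiable_continuous; apply/derivable1_diffP; case: (df t).
Qed.

Theorem theorem2p2 (R : realType) (n : nat) (Delta tau t0 : R)
    (F : R -> R -> R -> R) (y : R -> R) (x : nat -> R -> R)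
    (n_ge1 : (1 <= n)%N) (Delta_gt0 : 0 < Delta) (tau_ge0 : 0 <= tau)
    (y_cont : continuous y)
    (delay_term_defined : erlang_conv_defined Delta tau n y t0) :
  (forall (k : nat) (t : R), (1 <= k <= n)%N ->
     erlang_conv_defined Delta tau k y t) /\
  ((distributed_delay_equation n Delta tau t0 F y /\
    (forall (k : nat) (t : R), (1 <= k <= n)%N ->
       x k t = erlang_conv Delta tau k y t))
   <->
   (linear_chain_system n Delta tau t0 F y x /\
    (forall (k : nat) (t : R), (1 <= k <= n)%N -> t <= t0 ->
       x k t = erlang_conv Delta tau k y t))).
Proof.
(* From here the chain has length [n.+1], matching moments of order at most [n]. *)
case: n n_ge1 delay_term_defined => // n _ defined.
have mw := erlang_conv_defined_moments _ _ _ Delta_gt0 tau_ge0 y_cont _ _ defined.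
have dconv1 := is_derive_erlang_conv1 _ _ _ Delta_gt0 tau_ge0 y_cont _ mw.
have dconvS := is_derive_erlang_convS _ _ _ Delta_gt0 tau_ge0 y_cont _ mw.
split=> [[//|k] t|]; first exact: (moments_erlang_conv_defined _ _ _ _ _ n).
split=> [[dde xE]|[[yE x1E xSE] x0E]].
  have xconv k : (1 <= k <= n.+1)%N -> x k = erlang_conv Delta tau k y.
    by move=> kn; apply/funext => t; exact: xE.
  split=> [|k t kn _]; last exact: xE.
  split.
  - by rewrite xconv ?ltnS//=.
  - by rewrite xconv//; exact: solves_from_derive.
  - move=> [//|[//|k]] kn.
    rewrite (xconv k.+2 kn) (xconv k.+1 (ltnW kn)).
    by apply: solves_from_derive => t; exact: dconvS.
(* Induction along the chain: the history gives times up to [t0], uniqueness the later ones. *)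
have xE k t : (k <= n)%N -> x k.+1 t = erlang_conv Delta tau k.+1 y t.
  elim: k t => [|k IH] t kn; have [tt0|/ltW t0t] := leP t t0.
  - exact: x0E.
  - apply: (linear_ode_unique _ _ _ _ _ (fun t => y (t - tau)) x1E _ _ _ t0t);
      last exact: x0E.
    exact: solves_from_derive.
  - exact: x0E.
  have xS := xSE k.+2 kn.
  apply: (linear_ode_unique _ _ _ _ _ (x k.+1) xS _ _ _ t0t); last exact: x0E.
  (* By induction the inputs agree at all times, so [x k.+2] and the convolution solve the same
     equation. *)
  rewrite (_ : x k.+1 = erlang_conv Delta tau k.+1 y).
    by apply: solves_from_derive => s; exact: dconvS.
  by apply/funext => s; apply: IH; exact: ltnW.
split; last by move=> [//|k] t kn; exact: xE.
case: yE => cy dy; split => // t t0t.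
by rewrite -xE//; exact: dy.
Qed.
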